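(* Let $\boldsymbol d=(d_1,\dots,d_n)$ be an $n$-tuple of integers with $d_1>d_2>\dots>d_n\ge 0$, let $x_1,\dots,x_m\in\mathbb{C}$, and let $A=(x_k^{d_j})_{k=1,\dots,m;\,j=1,\dots,n}\in\mathbb{C}^{m\times n}$. Suppose that $A$ is injective. Let the partitions $\boldsymbol\lambda$ and $\boldsymbol\lambda[i]$ ($i=1,\dots,n$) be associated to $\boldsymbol d$ as in the context, fix a total order on the set $\binom{[m]}{n-1}$, and define $B\in\mathbb{C}^{n\times\binom{m}{n-1}}$, with columns indexed by $\boldsymbol l\in\binom{[m]}{n-1}$, by $$B_{i\boldsymbol l}=\frac{(-1)^i\,s_{\boldsymbol\lambda[i]}(\boldsymbol x_{\boldsymbol l})\,V(\boldsymbol x_{\boldsymbol l})}{\sqrt{\sum\limits_{\boldsymbol k\in\binom{[m]}{n}}|s_{\boldsymbol\lambda}(\boldsymbol x_{\boldsymbol k})V(\boldsymbol x_{\boldsymbol k})|^2}}.$$ Then the Moore–Penrose pseudoinverse $A^+=(A^*A)^{-1}A^*$ of $A$ satisfies $$A^+=BB^*A^*=B(AB)^*.$$ The orthogonal projection of $\mathbb{C}^m$ onto the image of $A$ is $P=AB(AB)^*$, and, with $P^\perp=\boldsymbol 1-P$, for every $\boldsymbol y\in\mathbb{C}^m$ the minimal value of $\|A\boldsymbol a-\boldsymbol y\|_2$ over $\boldsymbol a\in\mathbb{C}^n$ equals $\sqrt{\langle\boldsymbol y\,|\,P^\perp\boldsymbol y\rangle}$.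
   Context: $M^*=\overline{M}^T$ denotes the Hermitian transpose of a matrix $M$, $\langle\boldsymbol u\,|\,\boldsymbol v\rangle=\boldsymbol u^*\boldsymbol v$ is the standard Hermitian inner product (antilinear in the first argument), and $x^0=1$ for all $x\in\mathbb{C}$ (including $x=0$). For a positive integer $r$ put $\boldsymbol\delta(r)=(r-1,r-2,\dots,1,0)$. For $\boldsymbol z=(z_1,\dots,z_r)\in\mathbb{C}^r$ let $V(\boldsymbol z)=\prod_{1\le i<j\le r}(z_i-z_j)$ be the Vandermonde determinant. For a partition $\boldsymbol\mu=(\mu_1,\dots,\mu_r)$, i.e. integers $\mu_1\ge\dots\ge\mu_r\ge 0$, the Schur polynomial $s_{\boldsymbol\mu}$ in $r$ variables is the polynomial $$s_{\boldsymbol\mu}(\boldsymbol z)=\frac{\det\big(z_i^{\mu_j+r-j}\big)_{i,j=1,\dots,r}}{V(\boldsymbol z)}$$ (the numerator is divisible by $V$ as a polynomial, and $s_{\boldsymbol\mu}$ is evaluated as a polynomial, also at points with coinciding coordinates). For $r=0$ the Schur polynomial of the empty partition and $V$ are both equal to $1$. Partitions associated to $\boldsymbol d$: $\boldsymbol\lambda=\boldsymbol d-\boldsymbol\delta(n)$, i.e. $\lambda_k=d_k+k-n$ for $k=1,\dots,n$. For $i=1,\dots,n$ let $\boldsymbol d\langle i\rangle=(d_1,\dots,d_{i-1},d_{i+1},\dots,d_n)$ be the tuple with $d_i$ removed, and $\boldsymbol\lambda[i]=\boldsymbol d\langle i\rangle-\boldsymbol\delta(n-1)$, a partition with $n-1$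 entries (the empty partition if $n=1$). $[m]=\{1,\dots,m\}$, and $\binom{[m]}{r}$ is the collection of all $r$-element subsets of $[m]$; an element $\boldsymbol k\in\binom{[m]}{r}$ is written as $\boldsymbol k=(k_1,\dots,k_r)$ with $k_1<\dots<k_r$, and $\boldsymbol x_{\boldsymbol k}=(x_{k_1},\dots,x_{k_r})$. *)

(* Defs.v *)
From mathcomp Require Import all_boot all_order all_algebra.
From mathcomp Require Import reals.
From mathcomp Require Import complex.
From mathcomp Require Import mpoly.

Set Implicit Arguments.
Unset Strict Implicit.
Unset Printing Implicit Defensive.

Import Order.TTheory GRing.Theory Num.Theory.

Local Open Scope ring_scope.
Local Open Scope sesquilinear_scope.

(* Ordinals are 0-based: the k-th entry of the mathematical notation has index
   k.-1 here. *)

Definition vandermonde (R : comNzRingType) (r : nat) (z : 'I_r -> R) : R :=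
  \prod_(i < r) \prod_(j < r | (i < j)%N) (z i - z j).

Definition delta (r : nat) (j : 'I_r) : nat := r - j.+1.

Definition schur_num (R : comNzRingType) (r : nat) (mu : 'I_r -> nat)
    (z : 'I_r -> R) : R :=
  \det (\matrix_(i < r, j < r) z i ^+ (mu j + delta j)).

Lemma vandermonde_dvd_det (R : comNzRingType) (r : nat) (z : 'I_r -> R)
    (f : 'I_r -> {poly R}) :
  exists q : R, q * vandermonde z = \det (\matrix_(i < r, j < r) (f j).[z i]).
Proof.
elim: r z f => [|r IH] z f.
  by exists 1; rewrite mul1r det_mx00 /vandermonde big_ord0.
pose z' := fun i : 'I_r => z (lift ord0 i).
have fact j : {g : {poly R} | f j = g * ('X - (z ord0)%:P) + ((f j).[z ord0])%:P}.
  have : root (f j - ((f j).[z ord0])%:P) (z ord0) by rewrite rootE !hornerE subrr.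
  by move=> /factor_theorem /sig_eqW [g Hg]; exists g; rewrite -Hg subrK.
pose g j := sval (fact j).
have fE j x : (f j).[x] = (g j).[x] * (x - z ord0) + (f j).[z ord0].
  by rewrite {1}(svalP (fact j)) -/(g j) !hornerE.
pose M := \matrix_(i < r.+1, j < r.+1) (f j).[z i].
pose N : 'M_r.+1 := \matrix_(i, j)
  (if unlift ord0 i is Some i' then (g j).[z' i'] else (f j).[z ord0]).
pose L : 'M_r.+1 := \matrix_(i, j)
  (if unlift ord0 i is Some i'
   then (j == ord0)%:R + (z' i' - z ord0) *+ (i == j) else (j == ord0)%:R).
have ML : M = L *m N.
  apply/matrixP => i j; rewrite !mxE big_ord_recl !mxE unlift_none.
  case: (unliftP ord0 i) => [k|] -> /=; last first.
    by rewrite mul1r big1 ?addr0 // => k _; rewrite !mxE unlift_none mul0r.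
  rewrite mulr0n addr0 mul1r (bigD1 k) //= big1 => [|l lk].
    rewrite !mxE liftK eqxx mulr1n add0r addr0 fE addrC; congr (_ + _).
    by rewrite mulrC.
  by rewrite !mxE liftK (inj_eq lift_inj) [k == l]eq_sym (negbTE lk) mulr0n add0r mul0r.
have detL : \det L = \prod_(i < r) (z' i - z ord0).
  rewrite det_trig.
    rewrite big_ord_recl !mxE unlift_none eqxx mul1r; apply: eq_bigr => i _.
    by rewrite !mxE liftK /= eqxx mulr1n add0r.
  apply/is_trig_mxP => i j ij; rewrite !mxE.
  have -> : (j == ord0) = false.
    by apply/eqP => j0; move: ij; rewrite j0.
  case: unliftP => // k _.
  by rewrite [i == j](_ : _ = false) ?addr0 //; apply/eqP => E; rewrite E ltnn in ij.
have [q Hq] : exists q, q * vandermonde z' = \det N.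
  have Hc j : exists q, q * vandermonde z' = cofactor N ord0 j.
    have [q Hq] := IH z' (fun k => g (lift j k)).
    exists ((-1) ^+ (0 + j)%N * q); rewrite -mulrA Hq /cofactor; congr (_ * \det _).
    by apply/matrixP => a b; rewrite !mxE liftK.
  rewrite (expand_det_row N ord0).
  elim/big_ind: _ => [|a b [qa <-] [qb <-]|j _].
  - by exists 0; rewrite mul0r.
  - by exists (qa + qb); rewrite mulrDl.
  - by have [q <-] := Hc j; exists (N ord0 j * q); rewrite mulrA.
exists ((-1) ^+ r * q); rewrite -/M ML det_mulmx detL -Hq.
have -> : vandermonde z = (-1) ^+ r * (\prod_(i < r) (z' i - z ord0)) * vandermonde z'.
  rewrite /vandermonde big_ord_recl; congr (_ * _).
    rewrite big_mkcond big_ord_recl /= mul1r.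
    rewrite -[X in (-1) ^+ X]card_ord -prodrN.
    by apply: eq_bigr => i _; rewrite opprB.
  by apply: eq_bigr => i _; rewrite [LHS]big_mkcond big_ord_recl /= mul1r -big_mkcond.
rewrite mulrA mulrACA !mulrA -expr2 sqrr_sign mul1r; congr (_ * _); exact: mulrC.
Qed.

Lemma schur_subproof (R : comNzRingType) (r : nat) (mu : 'I_r -> nat) :
  exists s : {mpoly R[r]},
    s * vandermonde (fun i : 'I_r => 'X_i)
      == schur_num mu (fun i : 'I_r => 'X_i).
Proof.
have [s Hs] := vandermonde_dvd_det (fun i : 'I_r => 'X_i : {mpoly R[r]})
  (fun j => 'X^(mu j + delta j)).
exists s; apply/eqP; rewrite Hs; congr (\det _).
by apply/matrixP => i j; rewrite !mxE hornerXn.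
Qed.

Definition schur (R : comNzRingType) (r : nat) (mu : 'I_r -> nat) :
    {mpoly R[r]} :=
  xchoose (schur_subproof R mu).

Lemma schurE (R : comNzRingType) (r : nat) (mu : 'I_r -> nat) :
  schur R mu * vandermonde (fun i : 'I_r => 'X_i)
    = schur_num mu (fun i : 'I_r => 'X_i).
Proof. exact/eqP/(xchooseP (schur_subproof R mu)). Qed.

(* The truncated subtraction is exact for strictly decreasing d, for which
   d j >= r - j.+1. *)
Definition assoc_part (r : nat) (d : 'I_r -> nat) (j : 'I_r) : nat :=
  d j - delta j.

Definition remove_entry (n : nat) (d : 'I_n -> nat) (i : 'I_n) :
    'I_n.-1 -> nat :=
  fun j => d (lift i j).

Definition ksubset (m r : nat) := {k : {set 'I_m} | #|k| == r}.

(* The enumeration of a set of ordinals is increasing, so this is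
   (x_{k_1}, ..., x_{k_r}) with k_1 < ... < k_r. *)
Definition subtuple (T : Type) (m r : nat) (x : 'I_m -> T) (k : ksubset m r) :
    'I_r -> T :=
  fun i => x (enum_val (cast_ord (esym (eqP (valP k))) i)).

Section LeastSquares.

Variable C : numClosedFieldType.

Definition genVandermonde (m n : nat) (x : 'I_m -> C) (d : 'I_n -> nat) :
    'M[C]_(m, n) :=
  \matrix_(k < m, j < n) x k ^+ d j.

Definition schurV (r : nat) (mu : 'I_r -> nat) (z : 'I_r -> C) : C :=
  (schur C mu).@[z] * vandermonde z.

(* e lists the (n-1)-element subsets of [m] in their chosen order; the sign
   (-1)^i, with i counted from 1, becomes (-1)^+ i.+1. *)
Definition matB (m n : nat) (x : 'I_m -> C) (d : 'I_n -> nat)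
    (e : 'I_('C(m, n.-1)) -> ksubset m n.-1) : 'M[C]_(n, 'C(m, n.-1)) :=
  \matrix_(i < n, l < 'C(m, n.-1))
    ((-1) ^+ i.+1
       * schurV (assoc_part (remove_entry d i)) (subtuple x (e l))
     / sqrtC (\sum_(k : ksubset m n)
                `|schurV (assoc_part d) (subtuple x k)| ^+ 2)).

Definition is_pinv (m n : nat) (A : 'M[C]_(m, n)) (X : 'M[C]_(n, m)) : Prop :=
  [/\ A *m X *m A = A, X *m A *m X = X,
      (A *m X) ^t* = A *m X & (X *m A) ^t* = X *m A].

Definition inner (m : nat) (u v : 'cV[C]_m) : C := (u ^t* *m v) 0 0.

Definition norm2 (m : nat) (u : 'cV[C]_m) : C :=
  sqrtC (\sum_(i < m) `|u i 0| ^+ 2).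

Definition is_orth_proj (m : nat) (U : 'cV[C]_m -> Prop) (P : 'M[C]_m) : Prop :=
  forall y : 'cV[C]_m,
    U (P *m y) /\ (forall u : 'cV[C]_m, U u -> inner u (y - P *m y) = 0).

Definition in_image (m n : nat) (A : 'M[C]_(m, n)) (u : 'cV[C]_m) : Prop :=
  exists a : 'cV[C]_n, u = A *m a.

Definition is_min_value (T : Type) (f : T -> C) (v : C) : Prop :=
  (exists a : T, f a = v) /\ (forall a : T, v <= f a).

End LeastSquares.

(* Main.v *)
(* Write G = A^* A. The products s_mu V are the maximal minors of A and of A with
   a column removed. By Cauchy-Binet the sum under the square root in B is det G,
   and the entries of B B^* are the cofactors of G divided by det G, so that
   B B^* = G^-1; everything else is the usual theory of the normal equations. *)

Require Import Defs.
From mathcomp Require Import all_boot all_order all_algebra.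
From mathcomp Require Import reals.
From mathcomp Require Import complex.
From mathcomp Require Import mpoly.
From mathcomp Require Import perm.
From mathcomp Require Import ring.

Set Implicit Arguments.
Unset Strict Implicit.
Unset Printing Implicit Defensive.

Import Order.TTheory GRing.Theory Num.Theory.

Local Open Scope ring_scope.
Local Open Scope sesquilinear_scope.

(** * Enumerations of subsets and the Cauchy-Binet formula *)

Lemma subtuple_inj (m r : nat) (k : ksubset m r) :
  injective (subtuple id k : 'I_r -> 'I_m).
Proof. by move=> i j /enum_val_inj /cast_ord_inj. Qed.

Lemma subtuple_mem (m r : nat) (k : ksubset m r) (i : 'I_r) :
  subtuple id k i \in val k.
Proof. exact: enum_valP. Qed.

Lemma subtuple_surj (m r : nat) (k : ksubset m r) (a : 'I_m) :
  a \in val k -> exists i, a = subtuple id k i.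
Proof.
move=> ak; exists (cast_ord (eqP (valP k)) (enum_rank_in ak a)).
by rewrite /subtuple cast_ordK enum_rankK_in.
Qed.

(** An injective map [f] amounts to its image [k] together with the permutation that turns the
    increasing enumeration of [k] into [f]. *)
Lemma sum_inj_ksubset (V : nmodType) (m r : nat) (F : {ffun 'I_r -> 'I_m} -> V) :
  \sum_(f : {ffun 'I_r -> 'I_m} | injectiveb f) F f =
  \sum_(k : ksubset m r) \sum_(s : 'S_r) F [ffun i : 'I_r => subtuple id k (s i)].
Proof.
(* The inner sum has the single term [k0], the image of [f]; it is inserted so that the two sums can
   be exchanged. *)
transitivity (\sum_(f : {ffun 'I_r -> 'I_m} | injectiveb f)
                \sum_(k : ksubset m r | val k == [set f i | i : 'I_r]) F f).
  apply: eq_bigr => f /injectiveP f_inj.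
  have cf : #|[set f i | i : 'I_r]| == r by rewrite card_imset // card_ord.
  pose k0 : ksubset m r := Sub [set f i | i : 'I_r] cf.
  by rewrite (big_pred1 k0) // => k; rewrite /= -(inj_eq val_inj).
rewrite (exchange_big_dep xpredT) //=; apply: eq_bigr => k _.
pose h (s : 'S_r) := [ffun i : 'I_r => subtuple id k (s i)].
have h_inj : injective h.
  move=> s t /ffunP E; apply/permP => i; apply: (@subtuple_inj _ _ k).
  by have := E i; rewrite !ffunE.
transitivity (\sum_(f in [set h s | s : 'S_r]) F f); last first.
  rewrite big_imset => [|s t _ _]; last exact: h_inj.
  by apply: eq_bigl => s; rewrite inE.
apply: eq_bigl => f; apply/andP/imsetP => [[/injectiveP f_inj /eqP Ek]|[s _ ->]].
  have /fin_all_exists [u fu] i : exists j, f i = subtuple id k j.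
    by apply: subtuple_surj; rewrite /= Ek imset_f.
  have u_inj : injective u by move=> i j uij; apply: f_inj; rewrite !fu uij.
  by exists (perm u_inj) => //; apply/ffunP => i; rewrite ffunE permE.
have hs_inj : injective (h s).
  by move=> i j; rewrite !ffunE => /subtuple_inj /perm_inj.
split; first exact/injectiveP.
(* The image of [h s] has [r] elements, as many as [k], so one inclusion suffices. *)
rewrite eq_sym eqEcard card_imset // card_ord (eqP (valP k)) leqnn andbT.
by apply/subsetP => _ /imsetP[i _ ->]; rewrite ffunE subtuple_mem.
Qed.

(** In the Leibniz formula for the product, each entry is a sum over an intermediate index;
    distributing makes [f] the choice of these indices, one per row, and for fixed [f] the sum over
    permutations is again a determinant. *)
Lemma det_mulmx_sum_ffun (R : comNzRingType) (m r : nat)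
    (M : 'M[R]_(r, m)) (N : 'M[R]_(m, r)) :
  \det (M *m N) =
  \sum_(f : {ffun 'I_r -> 'I_m}) (\prod_i M i (f i)) * \det (rowsub f N).
Proof.
transitivity (\sum_(f : {ffun 'I_r -> 'I_m}) \sum_(s : 'S_r)
                (-1) ^+ s * \prod_i (M i (f i) * N (f i) (s i))).
  rewrite exchange_big; apply: eq_bigr => /= s _; rewrite -big_distrr /=.
  congr (_ * _); rewrite -(bigA_distr_bigA (fun i j => M i j * N j (s i))) /=.
  by apply: eq_bigr => i _; rewrite mxE.
apply: eq_bigr => f _; rewrite big_distrr /=; apply: eq_bigr => s _.
rewrite big_split /= mulrCA; congr (_ * (_ * _)).
by apply: eq_bigr => i _; rewrite mxE.
Qed.

(** A non-injective [f] repeats a row of [N] and contributes zero. The injective ones with image [k]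
    differ by a permutation of rows, whose sign combines with the product of entries of [M] into the
    Leibniz formula for the minor of [M]. *)
Lemma cauchy_binet (R : comNzRingType) (m r : nat)
    (M : 'M[R]_(r, m)) (N : 'M[R]_(m, r)) :
  \det (M *m N) =
  \sum_(k : ksubset m r)
    \det (colsub (subtuple id k) M) * \det (rowsub (subtuple id k) N).
Proof.
rewrite det_mulmx_sum_ffun (bigID (fun f : {ffun _ -> _} => injectiveb f)) /=.
rewrite [X in _ + X]big1 ?addr0 => [|f]; last first.
  case/injectivePn => i [j ij fij].
  by rewrite (determinant_alternate ij) ?mulr0 // => l; rewrite !mxE fij.
rewrite sum_inj_ksubset; apply: eq_bigr => k _; rewrite big_distrl /=.
apply: eq_bigr => s _.
have -> : rowsub [ffun i : 'I_r => subtuple id k (s i)] N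
          = perm_mx s *m rowsub (subtuple id k) N.
  by rewrite -row_permE; apply/matrixP => i j; rewrite !mxE ffunE.
rewrite det_mulmx det_perm mulrCA mulrA; congr (_ * _ * _).
by apply: eq_bigr => i _; rewrite mxE ffunE.
Qed.

(** * Schur polynomials times Vandermonde determinants as minors *)

(** The polynomial identity [schurE] is evaluated at [z]; nothing is divided, so coinciding
    coordinates do no harm. *)
Lemma schurV_num (C : numClosedFieldType) (r : nat) (mu : 'I_r -> nat)
    (z : 'I_r -> C) :
  schurV mu z = schur_num mu z.
Proof.
have := congr1 (meval z) (schurE C mu); rewrite mevalM /schurV.
have -> : (vandermonde (fun i : 'I_r => 'X_i : {mpoly C[r]})).@[z]
          = vandermonde z.
  rewrite /vandermonde rmorph_prod; apply: eq_bigr => i _.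
  rewrite rmorph_prod; apply: eq_bigr => j _.
  by rewrite /= mevalB !mevalXU.
move=> ->; rewrite /schur_num -det_map_mx; congr (\det _).
by apply/matrixP => i j; rewrite !mxE rmorphXn /= mevalXU.
Qed.

(** Exactly [delta j] entries follow [d j], and each step towards it from the last entry gains at
    least one. This makes the truncated subtraction in [assoc_part] exact. *)
Lemma delta_le (r : nat) (d : 'I_r -> nat) :
  (forall i j : 'I_r, (i < j)%N -> (d j < d i)%N) ->
  forall j, (delta j <= d j)%N.
Proof.
move=> d_decr j; rewrite /delta.
have [k] : exists k, (r - j.+1)%N = k by eexists.
elim: k j => [|k IH] j Ek; first by rewrite Ek.
have jr : (j.+1 < r)%N by rewrite -subn_gt0 Ek.
rewrite Ek; apply: leq_ltn_trans (d_decr j (Ordinal jr) (leqnn _)).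
have Ek' : (r - j.+2)%N = k by rewrite subnS Ek.
by have := IH (Ordinal jr) Ek'; rewrite /= Ek'.
Qed.

Lemma schurV_det (C : numClosedFieldType) (r : nat) (d : 'I_r -> nat)
    (z : 'I_r -> C) :
  (forall i j : 'I_r, (i < j)%N -> (d j < d i)%N) ->
  schurV (assoc_part d) z = \det (\matrix_(i < r, j < r) z i ^+ d j).
Proof.
move=> d_decr; rewrite schurV_num; congr (\det _).
by apply/matrixP => i j; rewrite !mxE subnK ?delta_le.
Qed.

Lemma remove_entry_decr (n : nat) (d : 'I_n -> nat) (i : 'I_n) :
  (forall j k : 'I_n, (j < k)%N -> (d k < d j)%N) ->
  forall j k : 'I_n.-1, (j < k)%N -> (remove_entry d i k < remove_entry d i j)%N.
Proof.
by move=> d_decr j k jk; apply: d_decr => /=; rewrite ltnNge leq_bump2 -ltnNge.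
Qed.

(** * Hermitian inner product, normal equations and least squares *)

Lemma trmxC_mul (C : numClosedFieldType) (m n p : nat)
    (M : 'M[C]_(m, n)) (N : 'M[C]_(n, p)) :
  (M *m N) ^t* = N ^t* *m M ^t*.
Proof. by rewrite trmx_mul map_mxM. Qed.

Lemma inner_norm (C : numClosedFieldType) (m : nat) (u : 'cV[C]_m) :
  inner u u = \sum_(i < m) `|u i 0| ^+ 2.
Proof.
by rewrite /inner mxE; apply: eq_bigr => i _; rewrite !mxE normCKC.
Qed.

Lemma inner_ge0 (C : numClosedFieldType) (m : nat) (u : 'cV[C]_m) :
  0 <= inner u u.
Proof. by rewrite inner_norm sumr_ge0 // => i _; rewrite exprn_ge0. Qed.

Lemma inner_eq0 (C : numClosedFieldType) (m : nat) (u : 'cV[C]_m) :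
  inner u u = 0 -> u = 0.
Proof.
rewrite inner_norm => /eqP; rewrite psumr_eq0 => [/allP u0|i _]; last first.
  by rewrite exprn_ge0.
apply/matrixP => i j; rewrite ord1 mxE; apply/eqP.
by rewrite -normr_eq0 -sqrf_eq0; apply: u0; rewrite mem_index_enum.
Qed.

Lemma innerC (C : numClosedFieldType) (m : nat) (u v : 'cV[C]_m) :
  inner u v = (inner v u)^*.
Proof.
rewrite /inner !mxE rmorph_sum; apply: eq_bigr => i _.
by rewrite !mxE rmorphM /= conjCK mulrC.
Qed.

Lemma innerDr (C : numClosedFieldType) (m : nat) (u v w : 'cV[C]_m) :
  inner u (v + w) = inner u v + inner u w.
Proof. by rewrite /inner mulmxDr mxE. Qed.

Lemma innerDl (C : numClosedFieldType) (m : nat) (u v w : 'cV[C]_m) :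
  inner (u + v) w = inner u w + inner v w.
Proof. by rewrite !(innerC _ w) innerDr rmorphD. Qed.

Lemma inner_mull (C : numClosedFieldType) (m n : nat) (A : 'M[C]_(m, n))
    (a : 'cV[C]_n) (y : 'cV[C]_m) :
  inner (A *m a) y = inner a (A ^t* *m y).
Proof. by rewrite /inner trmxC_mul mulmxA. Qed.

Lemma norm2_inner (C : numClosedFieldType) (m : nat) (u : 'cV[C]_m) :
  norm2 u = sqrtC (inner u u).
Proof. by rewrite inner_norm. Qed.

(** If a row [v] satisfies [v *m (A ^t* *m A) = 0], then [A *m v ^t*] has squared norm zero, so
    injectivity of [A] forces [v = 0]. *)
Lemma gram_unitmx (C : numClosedFieldType) (m n : nat) (A : 'M[C]_(m, n)) :
  injective (fun a : 'cV[C]_n => A *m a) -> A ^t* *m A \in unitmx.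
Proof.
move=> A_inj; rewrite -row_free_unit; apply: inj_row_free => v vG.
have : A *m v ^t* = A *m 0.
  rewrite mulmx0; apply: inner_eq0.
  rewrite inner_mull mulmxA /inner mulmxA trmxCK vG.
  by rewrite mul0mx mxE.
by move/A_inj => v0; rewrite -[v]trmxCK v0 trmx0 map_mx0.
Qed.

Lemma gram_pinv (C : numClosedFieldType) (m n : nat) (A : 'M[C]_(m, n)) :
  A ^t* *m A \in unitmx -> is_pinv A (invmx (A ^t* *m A) *m A ^t*).
Proof.
move=> G_unit; have XA : invmx (A ^t* *m A) *m A ^t* *m A = 1%:M.
  by rewrite -mulmxA mulVmx.
have GinvC : (invmx (A ^t* *m A)) ^t* = invmx (A ^t* *m A).
  by rewrite trmx_inv map_invmx trmxC_mul trmxCK.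
split.
- by rewrite -mulmxA XA mulmx1.
- by rewrite XA mul1mx.
- by rewrite !trmxC_mul trmxCK GinvC mulmxA.
- by rewrite XA trmx1 map_mx1.
Qed.

Lemma gram_orth_proj (C : numClosedFieldType) (m n : nat) (A : 'M[C]_(m, n)) :
  A ^t* *m A \in unitmx ->
  is_orth_proj (in_image A) (A *m (invmx (A ^t* *m A) *m A ^t*)).
Proof.
move=> G_unit y; split.
  by exists (invmx (A ^t* *m A) *m A ^t* *m y); rewrite !mulmxA.
move=> _ [a ->]; rewrite inner_mull mulmxBr !mulmxA mulmxV // mul1mx subrr.
by rewrite /inner mulmx0 mxE.
Qed.

(** By Pythagoras, the squared distance from [y] to [A *m a] is that from [y] to [P *m y] plus a
    nonnegative term, which vanishes for the [b] with [P *m y = A *m b]. *)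
Lemma orth_proj_min_value (C : numClosedFieldType) (m n : nat)
    (A : 'M[C]_(m, n)) (P : 'M[C]_m) :
  is_orth_proj (in_image A) P ->
  forall y : 'cV[C]_m,
    is_min_value (fun a : 'cV[C]_n => norm2 (A *m a - y))
      (sqrtC (inner y ((1%:M - P) *m y))).
Proof.
move=> P_proj y; have [[b Pb] P_orth] := P_proj y.
have pyth a : inner (A *m a - y) (A *m a - y)
    = inner (A *m (a - b)) (A *m (a - b)) + inner (y - P *m y) (y - P *m y).
  have orth : inner (A *m (b - a)) (y - P *m y) = 0.
    by apply: P_orth; exists (b - a).
  have innerN (u : 'cV[C]_m) : inner (- u) (- u) = inner u u.
    by rewrite !inner_norm; apply: eq_bigr => i _; rewrite mxE normrN.
  rewrite -innerN opprB.
  have -> : A *m (a - b) = - (A *m (b - a)) by rewrite -mulmxN opprB.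
  rewrite innerN.
  have -> : y - A *m a = A *m (b - a) + (y - P *m y).
    by rewrite mulmxBr -Pb [RHS]addrC addrA subrK.
  move: (y - _) orth => z orth.
  rewrite innerDr !innerDl orth (innerC z (A *m _)) orth rmorph0.
  by rewrite addr0 add0r.
(* The component [P *m y] of the left argument is orthogonal to the residual, so the left [y] may be
   replaced by the residual. *)
have -> : inner y ((1%:M - P) *m y) = inner (y - P *m y) (y - P *m y).
  have orth : inner (P *m y) (y - P *m y) = 0 by apply: P_orth; exists b.
  rewrite mulmxBl mul1mx; set z := y - _ in orth *.
  by rewrite -[y in LHS](subrK (P *m y)) -/z innerDl orth addr0.
split; last first.
  move=> a; rewrite norm2_inner ler_sqrtC ?nnegrE ?inner_ge0 //.
  by rewrite pyth lerDr inner_ge0.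
by exists b; rewrite norm2_inner pyth subrr mulmx0 /inner mulmx0 mxE add0r.
Qed.

(** * The matrix [B] as a factor of the inverse Gram matrix *)

Lemma matB_gram (C : numClosedFieldType) (m n : nat) (x : 'I_m -> C)
    (d : 'I_n -> nat) (e : 'I_('C(m, n.-1)) -> ksubset m n.-1) :
  (forall i j : 'I_n, (i < j)%N -> (d j < d i)%N) -> bijective e ->
  let A := genVandermonde x d in
  matB x d e *m (matB x d e) ^t* = (\det (A ^t* *m A))^-1 *: \adj (A ^t* *m A).
Proof.
move=> d_decr e_bij A.
have minorD k : schurV (assoc_part d) (subtuple x k)
    = \det (rowsub (subtuple id k) A).
  rewrite schurV_det //; congr (\det _).
  by apply/matrixP => i j; rewrite !mxE.
have minorB i l : schurV (assoc_part (remove_entry d i)) (subtuple x l)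
    = \det (rowsub (subtuple id l) (col' i A)).
  rewrite schurV_det; last exact: remove_entry_decr.
  by congr (\det _); apply/matrixP => a b; rewrite !mxE.
have colsubC r p (M : 'M[C]_(m, p)) (g : 'I_r -> 'I_m) :
    colsub g (M ^t*) = (rowsub g M) ^t*.
  by apply/matrixP => i j; rewrite !mxE.
have detC p (M : 'M[C]_p) : \det (M ^t*) = (\det M)^*.
  by rewrite det_map_mx det_tr.
have -> : \det (A ^t* *m A)
    = \sum_(k : ksubset m n) `|schurV (assoc_part d) (subtuple x k)| ^+ 2.
  rewrite cauchy_binet; apply: eq_bigr => k _.
  by rewrite colsubC detC minorD normCKC.
set D := \sum_k _.
have D_ge0 : 0 <= D by apply: sumr_ge0 => k _; rewrite exprn_ge0.
apply/matrixP => i j; rewrite !mxE /cofactor.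
(* Entry [(i, j)] of the adjugate is the cofactor at [(j, i)]. The submatrix in it is a product of
   two matrices obtained from [A] by deleting a column, so Cauchy-Binet applies to it as well. *)
have -> : row' j (col' i (A ^t* *m A)) = (col' j A) ^t* *m col' i A.
  by apply/matrixP => a b; rewrite !mxE; apply: eq_bigr => l _; rewrite !mxE.
(* The bijection [e] turns the sum over subsets into the sum over the columns of [B]. *)
rewrite cauchy_binet (reindex e) /=; last exact: onW_bij.
rewrite !big_distrr /=; apply: eq_bigr => l _.
rewrite !mxE -/D !minorB colsubC detC.
(* Since [D] is nonnegative, its root is real and fixed by conjugation; the two roots in the
   denominators multiply to [D], and the two extra signs from counting rows from 1 cancel. *)
rewrite !rmorphM fmorphV rmorphXn rmorphN1 /= (conj_Creal (sqrtC_real _)) //.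
rewrite -[in RHS](sqrtCK D) -exprVn exprD !exprS.
by ring.
Qed.

Theorem mainTheorem2 (R : realType) (m n : nat) (n_gt0 : (0 < n)%N)
    (d : 'I_n -> nat)
    (d_decr : forall i j : 'I_n, (i < j)%N -> (d j < d i)%N)
    (x : 'I_m -> R[i])
    (A : 'M[R[i]]_(m, n)) (A_def : A = genVandermonde x d)
    (A_inj : injective (fun a : 'cV[R[i]]_n => A *m a))
    (e : 'I_('C(m, n.-1)) -> ksubset m n.-1) (e_bij : bijective e)
    (B : 'M[R[i]]_(n, 'C(m, n.-1))) (B_def : B = matB x d e) :
  let Aplus := invmx (A ^t* *m A) *m A ^t* in
  let P := A *m B *m (A *m B) ^t* in
  [/\ A ^t* *m A \in unitmx /\ is_pinv A Aplus,
      Aplus = B *m B ^t* *m A ^t*,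
      B *m B ^t* *m A ^t* = B *m (A *m B) ^t*,
      is_orth_proj (in_image A) P
    & forall y : 'cV[R[i]]_m,
        is_min_value (fun a : 'cV[R[i]]_n => norm2 (A *m a - y))
          (sqrtC (inner y ((1%:M - P) *m y)))].
Proof.
move=> Aplus P; have G_unit := gram_unitmx A_inj.
have BB : B *m B ^t* = invmx (A ^t* *m A).
  (* For a unit matrix, [invmx] unfolds to the adjugate divided by the determinant. *)
  by rewrite B_def matB_gram // -A_def /invmx G_unit.
have P_proj : is_orth_proj (in_image A) P.
  rewrite /P trmxC_mul !mulmxA -(mulmxA A B) BB -mulmxA.
  exact: gram_orth_proj.
split=> //; first by split=> //; apply: gram_pinv.
- by rewrite BB.
- by rewrite trmxC_mul mulmxA.
- exact: orth_proj_min_value.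
Qed.
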